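(* Let $p=yu+z^2$, $v=xz+yp$, $w=x^2u-2xzp-yp^2$ in $\mathbb{C}[x][y,z,u]$, and let $f=y+xQ$ with $Q \in \mathbb{C}[x][v,w]$ (a Vénéreau-type polynomial). Then $f$ is a strongly $x$-residual coordinate in $\mathbb{C}[x][y,z,u]$ (over $A=\mathbb{C}[x]$).
   Context: For a commutative ring $A$ with one, $A^{[n]}$ denotes the polynomial ring in $n$ variables over $A$. A polynomial $f\in A^{[n]}$ is an $A$-coordinate (a coordinate of $A^{[n]}$) if there exist $f_2,\ldots,f_n\in A^{[n]}$ with $A[f,f_2,\ldots,f_n]=A^{[n]}$. Let $x\in A$ be a non-unit that is a non-zero divisor. A polynomial $f\in A^{[n]}$ is a strongly $x$-residual coordinate if its image $\bar f$ is a coordinate in $(A/xA)^{[n]}$ and $f$ is a coordinate in $(A_x)^{[n]}$, where $A_x$ is the localization of $A$ at the powers of $x$. *)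

(* Defs.v *)
From HB Require Import structures.
From mathcomp Require Import all_boot all_order all_algebra.
From mathcomp Require Import ring_quotient generic_quotient.
From mathcomp Require Import boolp reals complex mpoly ring.

Set Implicit Arguments.
Unset Strict Implicit.
Unset Printing Implicit Defensive.

Import GRing.Theory.
Local Open Scope ring_scope.
Local Open Scope quotient_scope.

Section Coordinate.
Variable A : comNzRingType.

(* h belongs to A[g_1, ..., g_k]. *)
Definition in_subalgebra n k (g : k.-tuple {mpoly A[n]}) (h : {mpoly A[n]}) :=
  exists q : {mpoly A[k]}, h = q \mPo g.

(* Polynomials in n.+1 variables, so that there is room for f; the equality
   A[f, g_1, ..., g_n] = A^[n.+1] is stated as the non-trivial inclusion. *)
Definition coordinate n (f : {mpoly A[n.+1]}) :=
  exists g : n.-tuple {mpoly A[n.+1]},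
    forall h : {mpoly A[n.+1]}, in_subalgebra [tuple of f :: g] h.

End Coordinate.

(* In a commutative ring, left-regular means not a zero divisor, and having no
   right inverse means not a unit. *)
Record regular_nonunit (A : comNzRingType) := RegularNonunit {
  rnu_val :> A;
  rnu_lreg : GRing.lreg rnu_val;
  rnu_nonunit : forall a, rnu_val * a <> 1
}.

Section Residue.
Variables (A : comNzRingType) (x : regular_nonunit A).

Definition principal_ideal : {pred A} :=
  fun a => `[< exists b, a = (x : A) * b >].

Lemma principal_idealr_closed : idealr_closed principal_ideal.
Proof.
split.
- by apply/asboolP; exists 0; rewrite mulr0.
- by apply/negP => /asboolP [b] /esym; apply: rnu_nonunit.
- move=> a u v /asboolP [b ->] /asboolP [c ->]; apply/asboolP.
  by exists (a * b + c); rewrite mulrDr mulrCA.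
Qed.

HB.instance Definition _ :=
  isIdealr.Build A principal_ideal principal_idealr_closed.

End Residue.

Section Localization.
Variables (A : comNzRingType) (x : regular_nonunit A).
Local Notation X := (x : A).

Lemma rnu_expI n : injective ( *%R (X ^+ n)).
Proof. exact: lregX (rnu_lreg (r := x)). Qed.

(* (a, n) stands for a / x ^ n.  The customary extra factor x ^ k in the
   equivalence is superfluous because x is regular. *)
Definition loc_equiv (s t : A * nat) := X ^+ t.2 * s.1 == X ^+ s.2 * t.1.

Lemma loc_equiv_refl : reflexive loc_equiv.
Proof. by move=> s; apply: eqxx. Qed.

Lemma loc_equiv_sym : ssrbool.symmetric loc_equiv.
Proof. by move=> s t; rewrite /loc_equiv eq_sym. Qed.

Lemma loc_equiv_trans : transitive loc_equiv.
Proof.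
move=> t s r /eqP st /eqP tr; apply/eqP; apply: (@rnu_expI t.2).
by rewrite mulrCA st mulrCA tr mulrCA.
Qed.

Canonical loc_equiv_rel :=
  EquivRel loc_equiv loc_equiv_refl loc_equiv_sym loc_equiv_trans.

Definition localization := {eq_quot loc_equiv}.

HB.instance Definition _ : EqQuotient _ loc_equiv localization :=
  EqQuotient.on localization.
HB.instance Definition _ := Choice.on localization.

Lemma locP (s t : A * nat) :
  reflect (X ^+ t.2 * s.1 = X ^+ s.2 * t.1)
          (\pi_localization s == \pi_localization t).
Proof. by rewrite eqmodE; apply: eqP. Qed.

Lemma loc_repr (s : A * nat) :
  X ^+ s.2 * (repr (\pi_localization s)).1
    = X ^+ (repr (\pi_localization s)).2 * s.1.
Proof. by apply/locP; rewrite reprK. Qed.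

Definition loc_add0 (s t : A * nat) : A * nat :=
  (X ^+ t.2 * s.1 + X ^+ s.2 * t.1, (s.2 + t.2)%N).
Definition loc_opp0 (s : A * nat) : A * nat := (- s.1, s.2).
Definition loc_mul0 (s t : A * nat) : A * nat := (s.1 * t.1, (s.2 + t.2)%N).

Definition loc_add := lift_op2 localization loc_add0.
Definition loc_opp := lift_op1 localization loc_opp0.
Definition loc_mul := lift_op2 localization loc_mul0.
Definition loc_of : A -> localization :=
  lift_embed localization (fun a => (a, 0%N)).
Canonical loc_of_pi_morph := PiEmbed loc_of.

Lemma pi_loc_add :
  {morph \pi_localization : s t / loc_add0 s t >-> loc_add s t}.
Proof.
move=> s t; unlock loc_add; apply/eqP/locP => /=.
move: (loc_repr s) (loc_repr t); set s' := repr _; set t' := repr _ => es et.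
rewrite !exprD !mulrDr; congr (_ + _).
  transitivity (X ^+ t.2 * X ^+ t'.2 * (X ^+ s'.2 * s.1)); first by ring.
  by rewrite -es; ring.
transitivity (X ^+ s.2 * X ^+ s'.2 * (X ^+ t'.2 * t.1)); first by ring.
by rewrite -et; ring.
Qed.
Canonical pi_loc_add_morph := PiMorph2 pi_loc_add.

Lemma pi_loc_opp : {morph \pi_localization : s / loc_opp0 s >-> loc_opp s}.
Proof.
move=> s; unlock loc_opp; apply/eqP/locP => /=.
by rewrite !mulrN loc_repr.
Qed.
Canonical pi_loc_opp_morph := PiMorph1 pi_loc_opp.

Lemma pi_loc_mul :
  {morph \pi_localization : s t / loc_mul0 s t >-> loc_mul s t}.
Proof.
move=> s t; unlock loc_mul; apply/eqP/locP => /=.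
by rewrite !exprD mulrACA -(loc_repr s) -(loc_repr t) mulrACA.
Qed.
Canonical pi_loc_mul_morph := PiMorph2 pi_loc_mul.

Lemma loc_addA : associative loc_add.
Proof.
elim/quotW=> s; elim/quotW=> t; elim/quotW=> r; rewrite !piE.
apply/eqP/locP; rewrite /loc_add0 /= !exprD; ring.
Qed.

Lemma loc_addC : commutative loc_add.
Proof.
elim/quotW=> s; elim/quotW=> t; rewrite !piE.
apply/eqP/locP; rewrite /loc_add0 /= !exprD; ring.
Qed.

Lemma loc_add0l : left_id (loc_of 0) loc_add.
Proof.
elim/quotW=> s; rewrite !piE.
apply/eqP/locP; rewrite /loc_add0 /= expr0 !add0n; ring.
Qed.

Lemma loc_addNl : left_inverse (loc_of 0) loc_opp loc_add.
Proof.
elim/quotW=> s; rewrite !piE.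
apply/eqP/locP; rewrite /loc_add0 /loc_opp0 /= !exprD; ring.
Qed.

HB.instance Definition _ :=
  GRing.isZmodule.Build localization loc_addA loc_addC loc_add0l loc_addNl.

Lemma loc_mulA : associative loc_mul.
Proof.
elim/quotW=> s; elim/quotW=> t; elim/quotW=> r; rewrite !piE.
apply/eqP/locP; rewrite /loc_mul0 /= !exprD; ring.
Qed.

Lemma loc_mulC : commutative loc_mul.
Proof.
elim/quotW=> s; elim/quotW=> t; rewrite !piE.
apply/eqP/locP; rewrite /loc_mul0 /= !exprD; ring.
Qed.

Lemma loc_mul1l : left_id (loc_of 1) loc_mul.
Proof.
elim/quotW=> s; rewrite !piE.
by apply/eqP/locP; rewrite /loc_mul0 /= mul1r add0n.
Qed.

Lemma loc_mulDl : left_distributive loc_mul loc_add.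
Proof.
elim/quotW=> s; elim/quotW=> t; elim/quotW=> r; rewrite !piE.
apply/eqP/locP; rewrite /loc_mul0 /loc_add0 /= !exprD; ring.
Qed.

Lemma loc_1_neq0 : loc_of 1 != loc_of 0.
Proof.
by rewrite piE /loc_equiv /= expr0 !mul1r oner_neq0.
Qed.

HB.instance Definition _ :=
  GRing.Zmodule_isComNzRing.Build localization
    loc_mulA loc_mulC loc_mul1l loc_mulDl loc_1_neq0.

Lemma loc_of_is_zmod_morphism : zmod_morphism loc_of.
Proof.
move=> a b; transitivity (loc_add (loc_of a) (loc_opp (loc_of b))) => //.
rewrite !piE; apply/eqP/locP.
by rewrite /loc_add0 /loc_opp0 /= expr0 !mul1r.
Qed.

Lemma loc_of_is_monoid_morphism : monoid_morphism loc_of.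
Proof.
split=> // a b; transitivity (loc_mul (loc_of a) (loc_of b)) => //.
by rewrite !piE; apply/eqP/locP.
Qed.

HB.instance Definition _ :=
  GRing.isZmodMorphism.Build A localization loc_of loc_of_is_zmod_morphism.
HB.instance Definition _ :=
  GRing.isMonoidMorphism.Build A localization loc_of
    loc_of_is_monoid_morphism.

Lemma loc_of_inj : injective loc_of.
Proof.
move=> a b; rewrite !piE => /eqP/locP /=.
by rewrite expr0 !mul1r.
Qed.

Lemma loc_of_inv : loc_of x * \pi_localization (1, 1%N) = 1.
Proof.
transitivity (loc_mul (loc_of x) (\pi_localization (1, 1%N))) => //.
transitivity (loc_of 1) => //; rewrite !piE.
by apply/eqP/locP; rewrite /loc_mul0 /= expr0 mul1r.
Qed.

End Localization.

(* \pi_{ideal_quot principal_ideal x} : A -> A / xA and loc_of x : A -> A_x are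
   applied to the coefficients of f. *)
Definition strongly_residual_coordinate (A : comNzRingType)
    (x : regular_nonunit A) n (f : {mpoly A[n.+1]}) :=
  coordinate (map_mpoly \pi_{ideal_quot principal_ideal x} f) /\
  coordinate (map_mpoly (loc_of x) f).

Section Venereau.
Variable K : comNzRingType.

Lemma polyX_lreg : GRing.lreg ('X : {poly K}).
Proof. exact/monic_lreg/monicX. Qed.

Lemma polyX_nonunit (a : {poly K}) : 'X * a <> 1.
Proof.
move=> /(congr1 (horner_eval 0)) /eqP.
by rewrite /horner_eval hornerM hornerX mul0r hornerC eq_sym oner_eq0.
Qed.

Definition polyX_regular_nonunit := RegularNonunit polyX_lreg polyX_nonunit.

Local Notation A := {poly K}.

(* A^[3] = K[x][y, z, u]: the coefficient ring is A = K[x]. *)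
Definition vx : {mpoly A[3]} := ('X : A)%:MP.
Definition vy : {mpoly A[3]} := 'X_(inord 0).
Definition vz : {mpoly A[3]} := 'X_(inord 1).
Definition vu : {mpoly A[3]} := 'X_(inord 2).

Definition venereau_p : {mpoly A[3]} := vy * vu + vz ^+ 2.
Definition venereau_v : {mpoly A[3]} := vx * vz + vy * venereau_p.
Definition venereau_w : {mpoly A[3]} :=
  vx ^+ 2 * vu - 2%:R * vx * vz * venereau_p - vy * venereau_p ^+ 2.

End Venereau.

(* Main.v *)
Require Import Defs.
From mathcomp Require Import all_boot all_order all_algebra.
From mathcomp Require Import reals complex mpoly.
From mathcomp Require Import ring_quotient generic_quotient boolp ring.

(** From [y w + v^2 = x^2 p] one recovers [p], then [z = (v - y p) / x] and
    [u = (w + 2 x z p + y p^2) / x^2] once [x] is inverted.  Hence [(y, v, w)]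
    is a coordinate system over [A_x], and so is its triangular perturbation
    [(y + x Q(v, w), v, w)].  Modulo [x], the polynomial [f] is just [y]. *)

Set Implicit Arguments.
Unset Strict Implicit.
Unset Printing Implicit Defensive.

Import GRing.Theory.
Local Open Scope ring_scope.

Section Subalgebra.
Variables (A : comNzRingType) (n k : nat) (g : k.-tuple {mpoly A[n]}).

Lemma in_subalgebraC (c : A) : in_subalgebra g c%:MP.
Proof. by exists c%:MP; rewrite comp_mpolyC. Qed.

Lemma in_subalgebraD (a b : {mpoly A[n]}) :
  in_subalgebra g a -> in_subalgebra g b -> in_subalgebra g (a + b).
Proof. by move=> [r ->] [s ->]; exists (r + s); rewrite rmorphD. Qed.

Lemma in_subalgebraM (a b : {mpoly A[n]}) :
  in_subalgebra g a -> in_subalgebra g b -> in_subalgebra g (a * b).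
Proof. by move=> [r ->] [s ->]; exists (r * s); rewrite rmorphM. Qed.

Lemma in_subalgebraB (a b : {mpoly A[n]}) :
  in_subalgebra g a -> in_subalgebra g b -> in_subalgebra g (a - b).
Proof. by move=> [r ->] [s ->]; exists (r - s); rewrite rmorphB. Qed.

Lemma in_subalgebra_tnth (i : 'I_k) : in_subalgebra g (tnth g i).
Proof. by exists 'X_i; rewrite comp_mpolyXU -tnth_nth. Qed.

(** Transitivity of generation. By induction on the terms of [q], only constants, sums and products
    of the entries of [h] occur. *)
Lemma in_subalgebra_comp m (h : m.-tuple {mpoly A[n]}) (q : {mpoly A[m]}) :
  (forall i, in_subalgebra g (tnth h i)) -> in_subalgebra g (q \mPo h).
Proof.
move=> hg; elim/mpolyind: q => [|c e q _ _ IHq].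
  by rewrite rmorph0 -mpolyC0; exact: in_subalgebraC.
rewrite rmorphD; apply: in_subalgebraD => //=.
rewrite comp_mpolyZ -mul_mpolyC; apply: in_subalgebraM.
  exact: in_subalgebraC.
rewrite comp_mpolyX.
elim/big_rec: _ => [|i a _ IHa]; first exact: (in_subalgebraC 1).
apply: in_subalgebraM => //.
elim: (e i) => [|d IHd]; first exact: (in_subalgebraC 1).
by rewrite exprS; exact: in_subalgebraM.
Qed.

(** Every [h] is its own composition with the variables, so generation only has to be tested on
    them. *)
Lemma in_subalgebraT :
  (forall i, in_subalgebra g 'X_i) -> forall h, in_subalgebra g h.
Proof.
move=> Xg h; rewrite -(comp_mpoly_id h).
by apply: in_subalgebra_comp => i; rewrite tnth_mktuple.
Qed.

End Subalgebra.

(** Serves to keep [Q] a polynomial in the images of [v] and [w] after passing to the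
    localization. *)
Lemma map_comp_mpoly (A B : comNzRingType) (phi : {rmorphism A -> B}) m n
    (h : m.-tuple {mpoly A[n]}) (q : {mpoly A[m]}) :
  map_mpoly phi (q \mPo h)
    = map_mpoly phi q \mPo [tuple of map (map_mpoly phi) h].
Proof.
elim/mpolyind: q => [|c e q _ _ IHq]; first by rewrite !rmorph0.
rewrite !rmorphD /= IHq; congr (_ + _).
rewrite comp_mpolyZ !map_mpolyZ comp_mpolyZ map_mpolyX !comp_mpolyX.
rewrite rmorph_prod; congr (_ *: _); apply: eq_bigr => i _ /=.
by rewrite rmorphXn tnth_map.
Qed.

Lemma ord3_ind (P : 'I_3 -> Prop) :
  P (inord 0) -> P (inord 1) -> P (inord 2) -> forall i, P i.
Proof. by move=> P0 P1 P2 i; rewrite -(inord_val i); case: i => [[|[|[|]]]]. Qed.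

Section VenereauOverUnit.
Variables (B : comNzRingType) (x xV : B).
Hypothesis xK : x * xV = 1.

Local Notation y := ('X_(inord 0) : {mpoly B[3]}).
Local Notation z := ('X_(inord 1) : {mpoly B[3]}).
Local Notation u := ('X_(inord 2) : {mpoly B[3]}).
Local Notation X := (x%:MP : {mpoly B[3]}).
Local Notation Y := (xV%:MP : {mpoly B[3]}).

(** [p], [v], [w] are given by equations so that they can be instantiated with images under a change
    of coefficients. The completing polynomials are [v] and [w]. *)
Lemma venereau_coordinate (p v w : {mpoly B[3]}) (q : {mpoly B[2]}) :
  p = y * u + z ^+ 2 -> v = X * z + y * p ->
  w = X ^+ 2 * u - 2%:R * X * z * p - y * p ^+ 2 ->
  coordinate (y + X * (q \mPo [tuple v; w])).
Proof.
move=> pE vE wE; exists [tuple v; w]; set F := y + _.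
set g := [tuple of F :: _].
have XY : X * Y = 1 by rewrite -mpolyCM xK.
have gF : in_subalgebra g F.
  by have := in_subalgebra_tnth g ord0.
have gv : in_subalgebra g v.
  by have := in_subalgebra_tnth g (lift ord0 ord0).
have gw : in_subalgebra g w.
  by have := in_subalgebra_tnth g ord_max.
have gX : in_subalgebra g X := in_subalgebraC g x.
have gY : in_subalgebra g Y := in_subalgebraC g xV.
have gq : in_subalgebra g (q \mPo [tuple v; w]).
  by apply: in_subalgebra_comp => -[[|[|]]].
have gy : in_subalgebra g y.
  have -> : y = F - X * (q \mPo [tuple v; w]) by rewrite addrK.
  exact: in_subalgebraB gF (in_subalgebraM gX gq).
have gp : in_subalgebra g p.
  (* In [y * w + v * v] the terms in [x y z p] and [y^2 p^2] cancel, leaving [x^2 (y u + z^2)]. *)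
  have -> : p = Y * Y * (y * w + v * v).
    (* With the factor [(X * Y) ^+ 2] explicit, the equality is a plain ring identity, independent
       of [X * Y = 1]. *)
    transitivity ((X * Y) ^+ 2 * p); first by rewrite XY expr1n mul1r.
    by rewrite wE vE pE; ring.
  by do ?[apply: in_subalgebraM | apply: in_subalgebraD].
have gz : in_subalgebra g z.
  have -> : z = Y * (v - y * p).
    transitivity (X * Y * z); first by rewrite XY mul1r.
    by rewrite vE; ring.
  by do ?[apply: in_subalgebraM | apply: in_subalgebraB].
have gu : in_subalgebra g u.
  (* The double and the square are expanded so that closure under sums and products suffices. *)
  have -> : u = Y * Y * (w + (X * z * p + X * z * p) + y * (p * p)).
    transitivity ((X * Y) ^+ 2 * u); first by rewrite XY expr1n mul1r.
    by rewrite wE; ring.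
  by do ?[apply: in_subalgebraM | apply: in_subalgebraD].
by apply: in_subalgebraT; exact: ord3_ind.
Qed.

End VenereauOverUnit.

Lemma coordinateX0 (B : comNzRingType) :
  coordinate ('X_(inord 0) : {mpoly B[3]}).
Proof.
exists [tuple 'X_(inord 1); 'X_(inord 2)]; apply: in_subalgebraT.
set g := [tuple of _ :: _].
apply: ord3_ind.
- by have := in_subalgebra_tnth g ord0.
- by have := in_subalgebra_tnth g (lift ord0 ord0).
- by have := in_subalgebra_tnth g ord_max.
Qed.

Theorem proposition17 (R : realType) (f Q : {mpoly {poly R[i]}[3]})
    (hQ : in_subalgebra
            [tuple venereau_v R[i]; venereau_w R[i]] Q)
    (hf : f = vy R[i] + vx R[i] * Q) :
  strongly_residual_coordinate (polyX_regular_nonunit R[i]) f.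
Proof.
set x := polyX_regular_nonunit _.
case: hQ => q QE; split.
  (* [x = x * 1] lies in the ideal, so the summand [x Q] vanishes modulo [x] whatever [Q] is. *)
  have pix : \pi_{ideal_quot principal_ideal x}%qT ('X : {poly R[i]}) = 0.
    rewrite -(rmorph0 \pi_{ideal_quot principal_ideal x}%qT).
    apply/eqP; rewrite -Quotient.idealrBE subr0.
    by apply/asboolP; exists 1; rewrite mulr1.
  rewrite hf rmorphD rmorphM /= /vx map_mpolyC.
  rewrite [X in X%:MP]pix mpolyC0 mul0r addr0.
  rewrite /vy map_mpolyX; exact: coordinateX0.
rewrite hf QE rmorphD rmorphM /= map_comp_mpoly.
(* Both tuples have the same underlying sequence by computation. *)
rewrite [X in _ \mPo X](_ : _ = [tuple map_mpoly (loc_of x) (venereau_v R[i]);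
  map_mpoly (loc_of x) (venereau_w R[i])]); last exact/val_inj.
rewrite /= /vx /vy map_mpolyC map_mpolyX.
(* The inverse of [x] is the fraction [1 / x]; what remains is that the defining equations of [p],
   [v], [w] survive the coefficient map. *)
apply: (venereau_coordinate (loc_of_inv x)
  (p := map_mpoly (loc_of x) (venereau_p R[i]))).
- by rewrite rmorphD rmorphM rmorphXn /= /vy /vz /vu !map_mpolyX.
- by rewrite rmorphD !rmorphM /= /vx /vy /vz map_mpolyC !map_mpolyX.
rewrite !rmorphB !(rmorphXn, rmorphM) rmorph_nat /=.
by rewrite /vx /vy /vz /vu map_mpolyC !map_mpolyX.
Qed.
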